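(* Let $n\ge 2$ be an integer and let $\varphi\in \operatorname{Aut}(\operatorname{BS}(1,n))$ be a non-trivial automorphism (i.e. $\varphi\neq \mathrm{id}$). Then either $\operatorname{Fix}\varphi\cong\mathbb{Z}$ or $\operatorname{Fix}\varphi\cong \mathbb{Z}\left[\tfrac{1}{n}\right]$ (as groups). When $\operatorname{Fix}\varphi\cong\mathbb{Z}$, a generator of $\operatorname{Fix}\varphi$ is computable.
   Context: $\operatorname{BS}(1,n)=\langle a,t\mid tat^{-1}=a^n\rangle$. For an automorphism $\varphi$ of a group $G$, $\operatorname{Fix}\varphi=\{g\in G\mid \varphi(g)=g\}$, a subgroup of $G$. $\mathbb{Z}\left[\tfrac1n\right]$ denotes the additive group $\{l/n^k\mid l\in\mathbb{Z},k\ge 0\}\subset\mathbb{Q}$. ''Computable'' means that there is an algorithm which, given $n$ and $\varphi$ (specified by the images of the two generators), outputs a generator. *)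

(* Defs.v *)
From HB Require Import structures.
From mathcomp Require Import all_boot all_order all_algebra.
From mathcomp Require Import boolp.

Set Implicit Arguments.
Unset Strict Implicit.
Unset Printing Implicit Defensive.

Import GRing.Theory Algebra.

(* A letter (x, false) is the generator x, and (x, true) is x^-1. *)
Definition word (X : Type) := seq (X * bool).

Inductive pres_eq (X : Type) (R : word X -> word X -> Prop) :
  word X -> word X -> Prop :=
| pres_rel u v : R u v -> pres_eq R u v
| pres_cancel x b : pres_eq R [:: (x, b); (x, ~~ b)] [::]
| pres_cat u u' v v' :
    pres_eq R u u' -> pres_eq R v v' -> pres_eq R (u ++ v) (u' ++ v')
| pres_refl u : pres_eq R u u
| pres_sym u v : pres_eq R u v -> pres_eq R v u
| pres_trans u v w : pres_eq R u v -> pres_eq R v w -> pres_eq R u w.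

Definition winv (X : Type) (u : word X) : word X :=
  rev [seq (l.1, ~~ l.2) | l <- u].

Section Presented.
Variables (X : choiceType) (R : word X -> word X -> Prop).

Definition pres_eqb : rel (word X) := fun u v => `[< pres_eq R u v >].

Lemma pres_eqb_refl : reflexive pres_eqb.
Proof. by move=> u; apply/asboolP/pres_refl. Qed.

Lemma pres_eqb_sym : symmetric pres_eqb.
Proof. by move=> u v; apply/asboolP/asboolP => /pres_sym. Qed.

Lemma pres_eqb_trans : transitive pres_eqb.
Proof.
by move=> v u w /asboolP uv /asboolP vw; apply/asboolP; apply: pres_trans vw.
Qed.

Canonical pres_equiv := EquivRel pres_eqb pres_eqb_refl pres_eqb_sym
  pres_eqb_trans.

Definition presented := {eq_quot pres_equiv}%qT.
HB.instance Definition _ := Choice.on presented.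
HB.instance Definition _ := EqQuotient.on presented.

Definition pres_class (u : word X) : presented := (\pi_presented u)%qT.

Lemma pres_classP (u v : word X) :
  pres_class u = pres_class v <-> pres_eq R u v.
Proof.
split=> [/eqP|uv]; last by apply/eqP; rewrite /pres_class eqmodE; apply/asboolP.
by rewrite /pres_class eqmodE => /asboolP.
Qed.

Lemma pres_classK (g : presented) : pres_class (repr g) = g.
Proof. exact: reprK. Qed.

Lemma pres_repr (u : word X) : pres_eq R (repr (pres_class u)) u.
Proof. by apply/pres_classP; rewrite pres_classK. Qed.

Lemma winv_cat (u v : word X) : winv (u ++ v) = winv v ++ winv u.
Proof. by rewrite /winv map_cat rev_cat. Qed.

Lemma winvK : involutive (@winv X).
Proof.
move=> u; rewrite /winv map_rev revK -map_comp map_id_in // => -[x b] _ /=.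
by rewrite negbK.
Qed.

Lemma pres_winvr (u : word X) : pres_eq R (u ++ winv u) [::].
Proof.
elim: u => [|[x b] u IHu]; first exact: pres_refl.
rewrite /winv /= rev_cons -cats1 catA -/(winv u).
apply: pres_trans (pres_cancel R x b).
exact: (pres_cat (pres_refl R [:: (x, b)]) (pres_cat IHu (pres_refl R _))).
Qed.

Lemma pres_winvl (u : word X) : pres_eq R (winv u ++ u) [::].
Proof. by rewrite -{2}[u]winvK; apply: pres_winvr. Qed.

Lemma pres_winv (u v : word X) : pres_eq R u v -> pres_eq R (winv u) (winv v).
Proof.
move=> uv; apply: (@pres_trans _ _ _ (winv u ++ (v ++ winv v))).
  rewrite -{1}[winv u]cats0; apply: pres_cat (pres_refl _ _) _.
  exact/pres_sym/pres_winvr.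
rewrite catA -[X in pres_eq _ _ X]cat0s; apply: pres_cat (pres_refl _ _).
apply: pres_trans (pres_winvl u); apply: pres_cat (pres_refl _ _) _.
exact: pres_sym.
Qed.

Definition pres_one : presented := pres_class [::].
Definition pres_mul (g h : presented) : presented :=
  pres_class (repr g ++ repr h).
Definition pres_inv (g : presented) : presented := pres_class (winv (repr g)).

Lemma pres_class_cat (u v : word X) :
  pres_class (u ++ v) = pres_mul (pres_class u) (pres_class v).
Proof. by apply/pres_classP/pres_sym/pres_cat; apply: pres_repr. Qed.

Lemma pres_class_winv (u : word X) :
  pres_class (winv u) = pres_inv (pres_class u).
Proof. by apply/pres_classP/pres_sym/pres_winv; apply: pres_repr. Qed.

Lemma pres_mulA : associative pres_mul.
Proof.
move=> f g h; rewrite -[f]pres_classK -[g]pres_classK -[h]pres_classK.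
by rewrite -!pres_class_cat catA.
Qed.

Lemma pres_mul1g : left_id pres_one pres_mul.
Proof. by move=> g; rewrite -[g]pres_classK -pres_class_cat. Qed.

Lemma pres_mulg1 : right_id pres_one pres_mul.
Proof. by move=> g; rewrite -[g]pres_classK -pres_class_cat cats0. Qed.

Lemma pres_mulVg : left_inverse pres_one pres_inv pres_mul.
Proof.
move=> g; rewrite -[g]pres_classK -pres_class_winv -pres_class_cat.
exact/pres_classP/pres_winvl.
Qed.

Lemma pres_mulgV : right_inverse pres_one pres_inv pres_mul.
Proof.
move=> g; rewrite -[g]pres_classK -pres_class_winv -pres_class_cat.
exact/pres_classP/pres_winvr.
Qed.

HB.instance Definition _ := isGroup.Build presented
  pres_mulA pres_mul1g pres_mulg1 pres_mulVg pres_mulgV.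

End Presented.

Variant bs_gen := gen_a | gen_t.

Definition bool_of_bs_gen x := if x is gen_a then false else true.
Definition bs_gen_of_bool b := if b then gen_t else gen_a.
Lemma bool_of_bs_genK : cancel bool_of_bs_gen bs_gen_of_bool.
Proof. by case. Qed.
HB.instance Definition _ := Countable.copy bs_gen (can_type bool_of_bs_genK).

Definition bs_word := word bs_gen.

Variant bs_rel (n : nat) : bs_word -> bs_word -> Prop :=
| BsRel : bs_rel n
    [:: (gen_t, false); (gen_a, false); (gen_t, true)]
    (nseq n (gen_a, false)).

Definition BS (n : nat) : groupType := presented (@bs_rel n).

Definition bs_eval (n : nat) (u : bs_word) : BS n := pres_class (@bs_rel n) u.
Definition bs_a (n : nat) : BS n := bs_eval n [:: (gen_a, false)].
Definition bs_t (n : nat) : BS n := bs_eval n [:: (gen_t, false)].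

Section Fix.
Variables (G : groupType) (phi : {multiplicative G -> G}).

Definition fixed : {pred G} := [pred g | phi g == g].

Lemma fixed_closed : group_closed fixed.
Proof.
have phiF g h : phi (g / h)%g = (phi g / phi h)%g.
  by rewrite -[in RHS](mulgVK h g) gmulfM mulgK.
split=> [|g h /eqP fg /eqP fh]; apply/eqP; last by rewrite phiF fg fh.
by rewrite -(mulgV (1%g : G)) phiF !mulgV.
Qed.

Definition Fix := {g : G | fixed g}.
HB.instance Definition _ := SubChoice.on Fix.
HB.instance Definition _ :=
  SubChoice_isSubGroup.Build G fixed Fix fixed_closed.

End Fix.

Definition isomorphic (G H : groupType) : Prop :=
  exists f : {multiplicative G -> H}, bijective f.

Definition is_generator (G : groupType) (A : {pred G}) (g : G) : Prop :=
  g \in A /\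
  forall h, h \in A -> exists k : nat, h = (g ^+ k)%g \/ h = (g ^- k)%g.

Section ZInv.
Local Open Scope ring_scope.
Variable n : nat.

Definition zinv_pred : {pred rat} :=
  [pred x : rat | `[< exists (l : int) (k : nat), x = l%:~R / n%:R ^+ k >]].

Lemma zinv_closed : zmod_closed zinv_pred.
Proof.
split=> [|_ _ /asboolP[l [k ->]] /asboolP[m [j ->]]]; apply/asboolP.
  by exists 0, 0%N; rewrite mul0r.
have [n0|n_neq0] := eqVneq (n%:R : rat) 0.
  have int0 (p : int) i : exists q : int, p%:~R / (n%:R : rat) ^+ i = q%:~R.
    case: i => [|i]; first by exists p; rewrite expr0 divr1.
    by exists 0; rewrite n0 expr0n invr0 mulr0.
  have [[p ->] [q ->]] := (int0 l k, int0 m j).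
  by exists (p - q), 0%N; rewrite expr0 divr1 intrB.
exists (l * n%:Z ^+ j - m * n%:Z ^+ k), (k + j)%N.
rewrite intrB !intrM !rmorphXn /= exprD invfM mulrBl.
have nj i : (n%:R : rat) ^+ i != 0 by rewrite expf_neq0.
congr (_ - _); last by rewrite mulrA mulfK.
by rewrite mulrA mulrAC mulfK.
Qed.

HB.instance Definition _ := GRing.isZmodClosed.Build rat zinv_pred zinv_closed.

Definition Zinv := {x : rat | zinv_pred x}.
HB.instance Definition _ := SubChoice.on Zinv.
HB.instance Definition _ := [SubChoice_isSubZmodule of Zinv by <:].

End ZInv.

Definition Z_group : groupType := to_multiplicative int.
Definition Zinv_group (n : nat) : groupType := to_multiplicative (Zinv n).

(* Kleene's partial recursive functions; a program is an element of recfun k,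
   and `computes f v y` says that it halts on input v with output y. *)
Inductive recfun : nat -> Type :=
| rec_zero : recfun 0
| rec_succ : recfun 1
| rec_proj k (i : 'I_k) : recfun k
| rec_comp k m (f : recfun m) (g : 'I_m -> recfun k) : recfun k
| rec_prec k (f : recfun k) (g : recfun k.+2) : recfun k.+1
| rec_mu k (f : recfun k.+1) : recfun k.

Inductive computes : forall k, recfun k -> k.-tuple nat -> nat -> Prop :=
| computes_zero (v : 0.-tuple nat) : computes rec_zero v 0
| computes_succ (v : 1.-tuple nat) : computes rec_succ v (thead v).+1
| computes_proj k (i : 'I_k) (v : k.-tuple nat) :
    computes (rec_proj i) v (tnth v i)
| computes_comp k m (f : recfun m) (g : 'I_m -> recfun k)
    (v : k.-tuple nat) (w : m.-tuple nat) y :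
    (forall i, computes (g i) v (tnth w i)) -> computes f w y ->
    computes (rec_comp f g) v y
| computes_prec0 k (f : recfun k) g (v : k.-tuple nat) y :
    computes f v y -> computes (rec_prec f g) [tuple of 0 :: v] y
| computes_precS k (f : recfun k) g (v : k.-tuple nat) x y z :
    computes (rec_prec f g) [tuple of x :: v] y ->
    computes g [tuple of [:: x, y & v]] z ->
    computes (rec_prec f g) [tuple of x.+1 :: v] z
| computes_mu k (f : recfun k.+1) (v : k.-tuple nat) y (z : nat -> nat) :
    (forall x, x < y -> computes f [tuple of x :: v] (z x).+1) ->
    computes f [tuple of y :: v] 0 ->
    computes (rec_mu f) v y.

(* Bijective base-4 numeration, with digits a = 1, a^-1 = 2, t = 3, t^-1 = 4. *)
Definition letter_code (l : bs_gen * bool) : nat :=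
  (if l.1 is gen_a then 0 else 2) + l.2 + 1.

Definition word_code (u : bs_word) : nat :=
  foldr (fun l c => letter_code l + 4 * c) 0 u.

(* Main.v *)
(** The group BS(1,n) is the semidirect product of Z[1/n] by Z, with a = (1, 0),
  t = (0, 1) and t acting as multiplication by n; an injective endomorphism is
  (x, k) |-> (alpha x + beta (n^k - 1)/(n - 1), k) with alpha <> 0, so that
  (x, k) is fixed iff (1 - alpha) x = beta (n^k - 1)/(n - 1).  If alpha = 1,
  then beta <> 0 and the fixed subgroup is {k = 0} = Z[1/n].  Otherwise x is
  determined by k and the fixed subgroup embeds in Z.  Writing
  1 - alpha = A/n^h and beta = B/n^h with A, B integers and D = |A|, a positive
  k occurs iff D divides B (1 + n + ... + n^(k-1)) n^i for some i, and i = D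
  always suffices; by pigeonhole such a k exists.  The least one is found by
  unbounded search, and gives the generator t^-D a^l t^(D+k) with
  l = B (1 + n + ... + n^(k-1)) n^D / A. *)

Require Import Defs.
From HB Require Import structures.
From mathcomp Require Import all_boot all_order all_algebra.
From mathcomp Require Import boolp.
From mathcomp Require Import zify ring.

Set Implicit Arguments.
Unset Strict Implicit.
Unset Printing Implicit Defensive.

Import Order.TTheory GRing.Theory Num.Theory.

(** * Partial recursive functions *)

(** Arguments are plain lists, of which only those of length [k] matter; this keeps dependent tuple
    types out of the closure properties below. *)
Definition recursive k (f : seq nat -> nat) : Prop :=
  exists F : recfun k, forall v : k.-tuple nat, computes F v (f v).

Lemma eq_rc k f g : recursive k f -> (forall s, size s = k -> f s = g s) ->
  recursive k g.
Proof.
by move=> [F FP] fg; exists F => v; rewrite -fg ?size_tuple //; apply: FP.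
Qed.

Lemma rc_nth k i : i < k -> recursive k (fun s => nth 0 s i).
Proof.
move=> ik; exists (rec_proj (Ordinal ik)) => v.
by rewrite -[nth _ _ _](tnth_nth 0 v (Ordinal ik)); apply: computes_proj.
Qed.

Lemma comp_rc k m f (gs : seq (seq nat -> nat)) :
  size gs = m -> recursive m f ->
  (forall i, i < m -> recursive k (nth (fun=> 0) gs i)) ->
  recursive k (fun s => f [seq g s | g <- gs]).
Proof.
move=> gsm [F FP] gsP.
have /fin_all_exists[G GP] (i : 'I_m) := gsP i (ltn_ord i).
exists (rec_comp F G) => v.
have szs : size [seq g (v : seq nat) | g : seq nat -> nat <- gs] == m.
  by rewrite size_map gsm.
apply: (@computes_comp _ _ _ _ _ (Tuple szs)) => [i|]; last exact: FP.
by rewrite (tnth_nth 0) /= (nth_map (fun=> 0)) ?gsm ?ltn_ord //; apply: GP.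
Qed.

Lemma comp1_rc k f g :
  recursive 1 f -> recursive k g -> recursive k (fun s => f [:: g s]).
Proof. by move=> fP gP; apply: (@comp_rc k 1 f [:: g]) => // -[]. Qed.

Lemma rc_succ k f : recursive k f -> recursive k (fun s => (f s).+1).
Proof.
apply: (@comp1_rc k (fun s => (nth 0 s 0).+1)); exists rec_succ => v.
have -> : nth 0 v 0 = thead v by rewrite /thead (tnth_nth 0).
exact: computes_succ.
Qed.

Lemma rc_const k c : recursive k (fun=> c).
Proof.
elim: c => [|c]; last exact: rc_succ.
apply: (@comp_rc k 0 (fun=> 0) [::]) => //.
by exists rec_zero => v; rewrite [v]tuple0; apply: computes_zero.
Qed.

(** In a primitive recursion the step function sees the counter, the previous value and then the
    parameters; this makes a function of the parameters available there. *)
Lemma rc_drop2 k f : recursive k f -> recursive k.+2 (fun s => f (drop 2 s)).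
Proof.
move=> fP; pose gs := [seq fun s => nth 0 s i | i <- iota 2 k].
have gsk : size gs = k by rewrite size_map size_iota.
apply: (@eq_rc _ (fun s => f [seq g s | g <- gs])).
  apply: (comp_rc gsk fP) => i ik.
  rewrite (nth_map 0) ?size_iota // nth_iota //.
  by apply: rc_nth; rewrite !ltnS.
move=> [|x [|y s]] //= [sk]; rewrite -map_comp drop0; congr f.
rewrite -[2]/(2 + 0) iotaDl -map_comp -sk.
rewrite -[RHS](mkseq_nth 0 s); exact: eq_map.
Qed.

(** [rec_prec] recurses on the head of its argument list; composing it with [c] and the [k]
    projections gives recursion up to a computed bound, with parameters. *)
Lemma rc_rec k g b c :
  recursive k c -> recursive k b ->
  recursive k.+2 (fun s => g (nth 0 s 0) (nth 0 s 1) (drop 2 s)) ->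
  recursive k (fun s => nat_rect (fun=> nat) (b s) (fun x y => g x y s) (c s)).
Proof.
move=> cP [B BP] [G GP].
pose f s := nat_rect (fun=> nat) (b (behead s))
  (fun x y => g x y (behead s)) (nth 0 s 0).
have fP : recursive k.+1 f.
  exists (rec_prec B G) => v; case: (tupleP v) => x {}v; rewrite /f /=.
  elim: x => [|x IHx]; first exact: computes_prec0.
  by apply: computes_precS IHx _; have := GP [tuple of [:: x, _ & v]];
    rewrite /= drop0; apply.
pose gs := c :: [seq fun s => nth 0 s i | i <- iota 0 k].
have gsk : size gs = k.+1 by rewrite /= size_map size_iota.
apply: (@eq_rc _ (fun s => f [seq h s | h <- gs])).
  apply: (comp_rc gsk fP) => -[//|i] ik.
  by rewrite /= (nth_map 0) ?size_iota // nth_iota //; apply: rc_nth.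
move=> s sk; rewrite /f /= -map_comp.
suff -> : [seq ((@^~ s) \o (fun i t => nth 0 t i)) i | i <- iota 0 k] = s by [].
rewrite -sk -[RHS](mkseq_nth 0 s); exact: eq_map.
Qed.

Lemma rc_mu k f : recursive k.+1 f ->
  exists F : recfun k, forall (v : k.-tuple nat) y,
    (forall x, x < y -> f (x :: v) != 0) -> f (y :: v) = 0 -> computes F v y.
Proof.
move=> [F FP]; exists (rec_mu F) => v y lt0 eq0.
(* The rule for minimisation asks for the predecessors of the nonzero values met before [y]. *)
apply: (@computes_mu _ _ _ _ (fun x => (f (x :: v)).-1)) => [x xy|].
  by have := FP [tuple of x :: v]; rewrite prednK // lt0n lt0.
by rewrite -eq0; apply: (FP [tuple of y :: v]).
Qed.

Lemma rc_add k f g : recursive k f -> recursive k g ->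
  recursive k (fun s => f s + g s).
Proof.
move=> fP gP; apply: (@eq_rc _ _ _ (@rc_rec _ (fun _ y _ => y.+1) _ _ fP gP _)).
  by apply: rc_succ; apply: rc_nth.
by move=> s _; elim: (f s) => //= x ->.
Qed.

Lemma rc_pred k f : recursive k f -> recursive k (fun s => (f s).-1).
Proof.
move=> fP; apply: (@eq_rc _ _ _
  (@rc_rec _ (fun x _ _ => x) _ _ fP (rc_const _ 0) _)).
  exact: rc_nth.
by move=> s _; case: (f s).
Qed.

Lemma rc_sub k f g : recursive k f -> recursive k g ->
  recursive k (fun s => f s - g s).
Proof.
move=> fP gP; apply: (@eq_rc _ _ _ (@rc_rec _ (fun _ y _ => y.-1) _ _ gP fP _)).
  by apply: rc_pred; apply: rc_nth.
by move=> s _; elim: (g s) => [|x /= ->]; rewrite ?subn0 ?subnS.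
Qed.

Lemma rc_mul k f g : recursive k f -> recursive k g ->
  recursive k (fun s => f s * g s).
Proof.
move=> fP gP; apply: (@eq_rc _ _ _
  (@rc_rec _ (fun _ y s => g s + y) _ _ fP (rc_const _ 0) _)).
  by apply: rc_add; [apply: rc_drop2 | apply: rc_nth].
by move=> s _; elim: (f s) => //= x ->; rewrite mulSn.
Qed.

Lemma rc_exp k f g : recursive k f -> recursive k g ->
  recursive k (fun s => f s ^ g s).
Proof.
move=> fP gP; apply: (@eq_rc _ _ _
  (@rc_rec _ (fun _ y s => f s * y) _ _ gP (rc_const _ 1) _)).
  by apply: rc_mul; [apply: rc_drop2 | apply: rc_nth].
by move=> s _; elim: (g s) => //= x ->; rewrite expnS.
Qed.

Lemma rc_leq k f g : recursive k f -> recursive k g ->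
  recursive k (fun s => (f s <= g s) : nat).
Proof.
move=> fP gP; apply: (@eq_rc _ (fun s => 1 - (f s - g s))).
  by apply: rc_sub (rc_const _ _) (rc_sub fP gP).
by move=> s _; rewrite -subn_eq0; case: (f s - g s).
Qed.

Definition distn m p := (m - p) + (p - m).

Lemma rc_distn k f g :
  recursive k f -> recursive k g -> recursive k (fun s => distn (f s) (g s)).
Proof. by move=> fP gP; apply: rc_add; apply: rc_sub. Qed.

Lemma rc_eq k f g : recursive k f -> recursive k g ->
  recursive k (fun s => (f s == g s) : nat).
Proof.
move=> fP gP; apply: eq_rc (rc_leq (rc_distn fP gP) (rc_const _ 0)) _.
by move=> s _; rewrite leqn0 addn_eq0 !subn_eq0 -eqn_leq.
Qed.

Lemma rc_sum k c (g : nat -> seq nat -> nat) :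
  recursive k c -> recursive k.+2 (fun s => g (nth 0 s 0) (drop 2 s)) ->
  recursive k (fun s => \sum_(i < c s) g i s).
Proof.
move=> cP gP; apply: (@eq_rc _ _ _
  (@rc_rec _ (fun x y s => y + g x s) _ _ cP (rc_const _ 0) _)).
  by apply: rc_add => //; apply: rc_nth.
move=> s _; elim: (c s) => [|x /= ->]; first by rewrite big_ord0.
by rewrite big_ord_recr.
Qed.

(** The quotient counts the positive multiples of [d] up to [m]; the factor [0 < d] reproduces the
    convention that division by 0 gives 0. *)
Lemma divn_sum m d : m %/ d = \sum_(i < m) (0 < d) * (i.+1 * d <= m).
Proof.
case: d => [|d]; first by rewrite divn0 big1.
under eq_bigr => i _ do rewrite mul1n -leq_divRL //.
have -> q : \sum_(i < m) (i < q) = minn m q.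
  elim: m => [|m IHm]; first by rewrite big_ord0 min0n.
  by rewrite big_ord_recr /= IHm; lia.
by apply/esym/minn_idPr/leq_div.
Qed.

Lemma rc_div k f d : recursive k f -> recursive k d ->
  recursive k (fun s => f s %/ d s).
Proof.
move=> fP dP.
apply: (@eq_rc _ (fun s => \sum_(i < f s) (0 < d s) * (i.+1 * d s <= f s))).
  apply: (rc_sum (g := fun i s => (0 < d s) * (i.+1 * d s <= f s))) => //.
  apply: rc_mul; first by apply: rc_leq (rc_const _ _) (rc_drop2 _).
  apply: rc_leq; last exact: rc_drop2.
  by apply: rc_mul (rc_drop2 _) => //; apply: rc_succ; apply: rc_nth.
by move=> s sk; rewrite -divn_sum.
Qed.

Lemma rc_mod k f d : recursive k f -> recursive k d ->
  recursive k (fun s => f s %% d s).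
Proof.
move=> fP dP; apply: (@eq_rc _ (fun s => f s - f s %/ d s * d s)).
  exact: rc_sub (rc_mul (rc_div _ _) _).
by move=> s _; rewrite {1}(divn_eq (f s) (d s)) addKn.
Qed.

(** * Reading words through their codes *)

(** A nonempty word has code d + 4c' with d between 1 and 4, so c' is the quotient of the
    predecessor by 4. Past the end of the word everything stays 0. *)
Definition suffix_code c i := iter i (fun x => x.-1 %/ 4) c.
Definition digit c i := suffix_code c i - 4 * suffix_code c i.+1.
(* [h] plus the exponent of [t] in the first [i] letters; the truncated
  subtraction is exact when [h] is at least the length of the word. *)
Definition height h c i :=
  nat_rect (fun=> nat) h (fun j x => x + (digit c j == 3) - (digit c j == 4)) i.
(* [n ^ h] times the contribution to the rational coordinate of the letters [a]
  (for [d = 1]) or [a^-1] (for [d = 2]). *)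
Definition weight d n m h c :=
  \sum_(i < m) (digit c i == d) * n ^ height h c i.
Definition prepend l m c := iter m (fun x => l + 4 * x) c.

Lemma rc_suffix k c i : recursive k c -> recursive k i ->
  recursive k (fun s => suffix_code (c s) (i s)).
Proof.
move=> cP iP; apply: (@eq_rc _ _ _
  (@rc_rec _ (fun _ y _ => y.-1 %/ 4) _ _ iP cP _)).
  by apply: rc_div (rc_const _ _); apply: rc_pred; apply: rc_nth.
by move=> s _; rewrite /suffix_code; elim: (i s) => //= x ->.
Qed.

Lemma rc_digit k c i : recursive k c -> recursive k i ->
  recursive k (fun s => digit (c s) (i s)).
Proof.
move=> cP iP; apply: rc_sub; first exact: rc_suffix.
by apply: rc_mul (rc_const _ _) _; apply: rc_suffix => //; apply: rc_succ.
Qed.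

Lemma rc_height k h c i :
  recursive k h -> recursive k c -> recursive k i ->
  recursive k (fun s => height (h s) (c s) (i s)).
Proof.
move=> hP cP iP; apply: (@rc_rec _ (fun j x s =>
  x + (digit (c s) j == 3) - (digit (c s) j == 4))) => //.
have dP d : recursive k.+2 (fun s => digit (c (drop 2 s)) (nth 0 s 0) == d).
  by apply: rc_eq (rc_const _ _); apply: rc_digit (rc_drop2 _) (rc_nth _).
by apply: rc_sub => //; apply: rc_add => //; apply: rc_nth.
Qed.

Lemma rc_weight k d n m h c : recursive k n -> recursive k m ->
  recursive k h -> recursive k c ->
  recursive k (fun s => weight d (n s) (m s) (h s) (c s)).
Proof.
move=> nP mP hP cP; apply: (@rc_sum _ _ (fun i s =>
  (digit (c s) i == d) * n s ^ height (h s) (c s) i)) => //.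
apply: rc_mul.
  by apply: rc_eq (rc_const _ _); apply: rc_digit (rc_drop2 _) (rc_nth _).
apply: rc_exp; first exact: rc_drop2.
by apply: rc_height; [apply: rc_drop2.. | apply: rc_nth].
Qed.

Lemma rc_prepend k l m c : recursive k l -> recursive k m -> recursive k c ->
  recursive k (fun s => prepend (l s) (m s) (c s)).
Proof.
move=> lP mP cP; apply: (@eq_rc _ _ _
  (@rc_rec _ (fun _ y s => l s + 4 * y) _ _ mP cP _)).
  apply: rc_add; first exact: rc_drop2.
  by apply: rc_mul (rc_const _ _) (rc_nth _).
by move=> s _; rewrite /prepend; elim: (m s) => //= x ->.
Qed.

(** * Group morphisms *)

Lemma inj_surj_bij (S T : Type) (f : S -> T) :
  injective f -> (forall y, exists x, f x = y) -> bijective f.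
Proof.
move=> injf /choice[g fg]; exists g => // x; exact/injf/fg.
Qed.

Lemma isomorphic_intro (G H : groupType) (f : G -> H) :
  {morph f : x y / (x * y)%g} -> injective f -> (forall y, exists x, f x = y) ->
  isomorphic G H.
Proof.
move=> fM injf surjf.
pose F : {multiplicative G -> H} := HB.pack f (isMultiplicative.Build _ _ f fM).
exists F; exact: inj_surj_bij.
Qed.

Section Hom.
Variables (G H : groupType) (f : {multiplicative G -> H}).

Lemma hom1 : f 1%g = 1%g.
Proof. by apply: (mulIg (f 1%g)); rewrite -gmulfM !mul1g. Qed.

Lemma homV g : f g^-1%g = (f g)^-1%g.
Proof. by apply: (mulIg (f g)); rewrite -gmulfM !mulVg hom1. Qed.

Lemma homX g m : f (g ^+ m)%g = (f g ^+ m)%g.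
Proof.
by elim: m => [|m IHm]; rewrite ?expg0 ?hom1 // !expgS gmulfM IHm.
Qed.

End Hom.

(** * Coordinates on BS(1,n) *)

Section Coordinates.
Local Open Scope ring_scope.
Variable n : nat.
Hypothesis n_gt1 : (1 < n)%N.

Let q : rat := n%:R.

Lemma q_neq0 : q != 0.
Proof. by rewrite pnatr_eq0; lia. Qed.

Lemma q_gt1 : 1 < q.
Proof. by rewrite ltr1n. Qed.

(* The product of the semidirect product of [Z[1/n]] by [Z]. *)
Definition smul (x y : rat * int) : rat * int :=
  (x.1 + q ^ x.2 * y.1, x.2 + y.2).

Definition letter_coords (l : bs_gen * bool) : rat * int :=
  if l.1 is gen_a then ((-1) ^+ l.2, 0) else (0, (-1) ^+ l.2).

Definition word_coords (u : bs_word) : rat * int :=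
  foldr (fun l => smul (letter_coords l)) (0, 0) u.

Lemma smulA : associative smul.
Proof.
move=> x y z; rewrite /smul /= addrA; congr (_, _).
by rewrite expfzDr ?q_neq0 // mulrDr !addrA !mulrA.
Qed.

Lemma smul0s x : smul (0, 0) x = x.
Proof. by case: x => x k; rewrite /smul /= expr0z mul1r !add0r. Qed.

Lemma word_coords_cat u v :
  word_coords (u ++ v) = smul (word_coords u) (word_coords v).
Proof. by elim: u => [|l u IHu] /=; rewrite ?smul0s // IHu smulA. Qed.

Lemma word_coords_nseq_a m b :
  word_coords (nseq m (gen_a, b)) = ((-1) ^+ b * m%:R, 0).
Proof.
elim: m => [|m IHm] /=; first by rewrite mulr0.
by rewrite IHm /smul /= expr0z mul1r [m.+1%:R]mulrS mulrDr mulr1.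
Qed.

Lemma word_coords_nseq_t m b :
  word_coords (nseq m (gen_t, b)) = (0, (-1) ^+ b * m%:Z).
Proof.
elim: m => [|m IHm] /=; first by rewrite mulr0.
rewrite IHm /smul /= !mulr0 !addr0; congr (_, _).
by rewrite intS mulrDr mulr1.
Qed.

(** Both sides of the defining relation have coordinates (n, 0), and the product is associative, so
    the coordinates descend to the quotient. *)
Lemma word_coords_sound u v :
  pres_eq (@bs_rel n) u v -> word_coords u = word_coords v.
Proof.
elim=> {u v} [_ _ []|x b|u u' v v' _ IHu _ IHv|//|u v _ -> //|
  u v w _ -> _ -> //].
- rewrite word_coords_nseq_a /= /smul /= !(mulr0, addr0, add0r, mul1r).
  by rewrite !expr0 expr1z mulr1.
- by case: x b => -[]; rewrite /= /smul /= !(mulr0, addr0) ?expr0z ?mul1r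
    ?addrN ?addNr.
- by rewrite !word_coords_cat IHu IHv.
Qed.

Definition coords (g : BS n) : rat * int := word_coords (repr g).

Lemma coords_eval u : coords (bs_eval n u) = word_coords u.
Proof. exact/word_coords_sound/pres_repr. Qed.

Lemma bs_eval_repr g : bs_eval n (repr g) = g.
Proof. exact: pres_classK. Qed.

Lemma bs_eval_cat u v : bs_eval n (u ++ v) = (bs_eval n u * bs_eval n v)%g.
Proof. exact: pres_class_cat. Qed.

Lemma coordsM g h : coords (g * h)%g = smul (coords g) (coords h).
Proof.
by rewrite -[g]bs_eval_repr -[h]bs_eval_repr -bs_eval_cat !coords_eval
  word_coords_cat.
Qed.

Lemma coords1 : coords 1%g = (0, 0).
Proof. exact: (coords_eval [::]). Qed.

Lemma coordsV g :
  coords g^-1%g = (- q ^ (- (coords g).2) * (coords g).1, - (coords g).2).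
Proof.
have := coordsM g^-1%g g; rewrite mulVg coords1.
case: (coords g) => x k; case: (coords g^-1%g) => y j [] /= /esym e /esym.
move/eqP; rewrite addr_eq0 => /eqP jk; rewrite jk in e *.
by congr (_, _); rewrite mulNr; apply/eqP; rewrite -addr_eq0 e.
Qed.

Lemma coords_bs_a : coords (bs_a n) = (1, 0).
Proof. by rewrite coords_eval /= /smul /= expr0z mulr0 addr0. Qed.

Lemma coords_bs_t : coords (bs_t n) = (0, 1).
Proof. by rewrite coords_eval /= /smul /= mulr0 addr0. Qed.

Lemma coordsX g m : (coords (g ^+ m)%g).2 = (coords g).2 * m%:Z.
Proof.
elim: m => [|m IHm]; first by rewrite expg0 coords1 mulr0.
by rewrite expgS coordsM /= IHm intS mulrDr mulr1.
Qed.

Lemma coordsX0 g m : (coords g).2 = 0 ->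
  coords (g ^+ m)%g = ((coords g).1 * m%:R, 0).
Proof.
move=> g0; elim: m => [|m IHm]; first by rewrite expg0 coords1 mulr0.
by rewrite expgS coordsM IHm /smul g0 /= expr0z mul1r addr0 [m.+1%:R]mulrS
  mulrDr mulr1.
Qed.

(** * Normal forms and faithfulness of the coordinates *)

(** The word t^-i a^(p - r) t^j, with the integer exponent of a split into two natural numbers. It
    is not unique for a given element. *)
Definition nf_word i p r j : bs_word :=
  nseq i (gen_t, true) ++ nseq p (gen_a, false) ++ nseq r (gen_a, true) ++
  nseq j (gen_t, false).

Lemma word_coords_nf i p r j :
  word_coords (nf_word i p r j) =
  ((p%:R - r%:R) / q ^+ i, j%:Z - i%:Z).
Proof.
rewrite !word_coords_cat !word_coords_nseq_a !word_coords_nseq_t /smul /=.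
rewrite !expr0z; congr (_, _); last by lia.
by rewrite mulN1r -exprz_inv -exprnP exprVn; field; rewrite expf_neq0 ?q_neq0.
Qed.

Local Notation a := (bs_a n).
Local Notation t := (bs_t n).

Lemma bs_eval_nseq m l : bs_eval n (nseq m l) = (bs_eval n [:: l] ^+ m)%g.
Proof.
by elim: m => [|m IHm] //; rewrite expgS -IHm -bs_eval_cat.
Qed.

Lemma bs_eval_inv x :
  bs_eval n [:: (x, true)] = (bs_eval n [:: (x, false)])^-1%g.
Proof. exact: (pres_class_winv _ [:: (x, false)]). Qed.

Lemma bs_eval_nf i p r j :
  bs_eval n (nf_word i p r j) = (t ^- i * (a ^+ p / a ^+ r) * t ^+ j)%g.
Proof.
by rewrite /nf_word !bs_eval_cat !bs_eval_nseq !bs_eval_inv !expVgn !mulgA.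
Qed.

Lemma bs_ta : (t * a = a ^+ n * t)%g.
Proof.
have e : (t * a * t^-1 = a ^+ n)%g.
  rewrite /t /a -bs_eval_inv -bs_eval_nseq -!bs_eval_cat.
  by apply/pres_classP; apply: pres_rel; apply: BsRel.
by rewrite -e mulgVK.
Qed.

Lemma bs_taX p : (t * a ^+ p = a ^+ (n * p) * t)%g.
Proof.
elim: p => [|p IHp]; first by rewrite muln0 !expg0 mulg1 mul1g.
by rewrite expgS mulgA bs_ta -mulgA IHp mulgA -expgnDr mulnS.
Qed.

Lemma bs_tXa i : (t ^+ i * a = a ^+ (n ^ i)%N * t ^+ i)%g.
Proof.
elim: i => [|i IHi]; first by rewrite expg0 mulg1 mul1g.
by rewrite !expgS -mulgA IHi mulgA bs_taX -expnS -mulgA.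
Qed.

(** The elements of this form include 1 and are stable under left multiplication by each of the four
    letters. *)
Lemma bs_nf g : exists i p r j, g = bs_eval n (nf_word i p r j).
Proof.
rewrite -[g]bs_eval_repr; elim: (repr g : bs_word) =>
  [|l u [i [p [r [j IHu]]]]].
  by exists 0%N, 0%N, 0%N, 0%N.
have comm_a x y : commute (a ^+ x) (a ^- y)%g.
  exact/commuteV/commuteX2/commute_refl.
have at_i : (a * t ^- i = t ^- i * a ^+ (n ^ i)%N)%g.
  by rewrite -[a in LHS](mulKg (t ^+ i)%g) bs_tXa -!mulgA mulgV mulg1.
rewrite -cat1s bs_eval_cat IHu; case: l => -[] [].
- exists i, p, (r + n ^ i)%N, j; rewrite !bs_eval_nf bs_eval_inv.
  have -> : (bs_eval n [:: (gen_a, false)])^-1%g = a^-1%g by [].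
  have Vat : (a^-1 * t ^- i = t ^- i * a ^- (n ^ i)%N)%g.
    by apply: (mulgI a); rewrite mulVKg mulgA at_i mulgK.
  rewrite !mulgA Vat; congr (_ * _)%g; rewrite -!mulgA; congr (_ * _)%g.
  by rewrite mulgA -comm_a -mulgA -invgM -expgnDr.
- exists i, (n ^ i + p)%N, r, j; rewrite !bs_eval_nf.
  have -> : bs_eval n [:: (gen_a, false)] = a by [].
  by rewrite !mulgA at_i expgnDr !mulgA.
- exists i.+1, p, r, j; rewrite !bs_eval_nf bs_eval_inv.
  have -> : bs_eval n [:: (gen_t, false)] = t by [].
  by rewrite expgSr invgM !mulgA.
have -> : bs_eval n [:: (gen_t, false)] = t by [].
(* A letter t cancels against t^-i if i > 0; otherwise it moves right across the powers of a and
   multiplies their exponents by n. *)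
case: i {IHu at_i} => [|i].
  exists 0%N, (n * p)%N, (n * r)%N, j.+1;
    rewrite !bs_eval_nf expg0 invg1 !mul1g.
  have e : (t * a ^- r = a ^- (n * r) * t)%g.
    by apply: (mulIg (a ^+ r)%g); rewrite mulgVK -mulgA bs_taX mulKg.
  by rewrite expgS !mulgA bs_taX -(mulgA _ t) e !mulgA.
exists i, p, r, j; rewrite !bs_eval_nf expgSr invgM !mulgA mulgV.
by rewrite mul1g.
Qed.

(** For a normal form, trivial coordinates force p = r and i = j, hence a trivial element; the
    general case applies this to g / h. *)
Lemma coords_inj : injective coords.
Proof.
have ker g : coords g = (0, 0) -> g = 1%g.
  have [i [p [r [j ->]]]] := bs_nf g; rewrite coords_eval word_coords_nf.
  move=> [/eqP]; rewrite mulf_eq0 invr_eq0 (negbTE (expf_neq0 _ q_neq0)) orbF.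
  rewrite subr_eq0 eqr_nat => /eqP -> /eqP; rewrite subr_eq0 => /eqP[->].
  by rewrite bs_eval_nf mulgV mulg1 mulVg.
move=> g h gh; apply/eqP; rewrite -divg_eq1; apply/eqP/ker.
rewrite coordsM coordsV gh /smul /= subrr mulrA mulrN -expfzDr ?q_neq0 //.
by rewrite subrr expr0z mulN1r subrr.
Qed.

Lemma coords1_den g : exists i (l : int), (coords g).1 = l%:~R / q ^+ i.
Proof.
have [i [p [r [j ->]]]] := bs_nf g; rewrite coords_eval word_coords_nf.
by exists i, (p%:Z - r%:Z); rewrite intrB.
Qed.

End Coordinates.

(** * Endomorphisms and their fixed points *)

(** One prime p of D at a time: if p divides n, the p-part of D divides n^D because the p-adic
    valuation of D is less than D; otherwise it is coprime to n^i and divides y. *)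
Lemma dvdn_expn_stable D y n i : 0 < D -> D %| y * n ^ i -> D %| y * n ^ D.
Proof.
move=> D0 Dy; apply/(dvdn_partP _ D0) => p; rewrite mem_primes =>
  /and3P[pr _ pD].
have [pn|pn] := boolP (p %| n).
  apply/dvdn_mull/dvdn_trans/(dvdn_exp2r D pn).
  by rewrite p_part dvdn_exp2l // ltnW // ltn_logl.
apply: dvdn_mulr; rewrite -(@Gauss_dvdl _ _ (n ^ i)).
  exact: dvdn_trans (dvdn_part _ _) Dy.
by rewrite p_part coprimeXl // coprimeXr // prime_coprime.
Qed.

Definition geom n k := \sum_(i < k) n ^ i.

Lemma geomD n i j : geom n (i + j) = geom n i + n ^ i * geom n j.
Proof.
rewrite /geom big_split_ord /= big_distrr /=; congr (_ + _).
by apply: eq_bigr => k _; rewrite expnD.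
Qed.

(** Among the sums for 0, ..., D two agree modulo D, and their difference is n^i times the sum for j
    - i. The factor n^i is then traded for n^D. *)
Lemma exists_geom_dvdn n D : 0 < D -> exists2 k, 0 < k & D %| geom n k * n ^ D.
Proof.
case: D => // D _; pose f (i : 'I_D.+2) : 'I_D.+1 := inord (geom n i %% D.+1).
have /injectivePn[i [j ij fij]] : ~~ injectiveb f.
  by apply/negP => /injectiveP/leq_card; rewrite !card_ord ltnn.
wlog lt_ij : i j ij fij / i < j => [IH|].
  have [lt|lt|/val_inj e] := ltngtP i j; first exact: IH lt.
    by apply: IH lt => //; rewrite eq_sym.
  by rewrite e eqxx in ij.
exists (j - i); first by rewrite subn_gt0.
apply: (@dvdn_expn_stable _ _ _ i) => //.
move/(congr1 val): fij; rewrite /= !inordK ?ltn_mod // => /eqP.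
have -> : geom n j = geom n i + n ^ i * geom n (j - i).
  by rewrite -geomD subnKC // ltnW.
rewrite eq_sym eqn_mod_dvd ?leq_addr //.
by rewrite addKn mulnC; apply.
Qed.

(** * Injective endomorphisms in coordinates *)

Section Injective.
Local Open Scope ring_scope.
Variables (n : nat) (phi : {multiplicative BS n -> BS n}).
Hypotheses (n_gt1 : (1 < n)%N) (phi_inj : injective phi).

Let q : rat := n%:R.
Let q_neq0 : q != 0 := q_neq0 n_gt1.
Let q_gt1 : 1 < q := q_gt1 n_gt1.
Let q1_neq0 : q - 1 != 0.
Proof. by rewrite subr_eq0 gt_eqF. Qed.

Local Notation a := (bs_a n).
Local Notation t := (bs_t n).
Local Notation alpha := (coords (phi a)).1.
Local Notation beta := (coords (phi t)).1.

(** The image of the relation ta = a^n t shows that the height of [phi a] equals n times itself. *)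
Lemma phi_a_height : (coords (phi a)).2 = 0.
Proof.
have /(congr1 (fun g => (coords (phi g)).2)) := bs_ta n.
rewrite !gmulfM !homX !(coordsM n_gt1) /= (coordsX n_gt1).
by move: (coords _).2 (coords _).2 => x y; nia.
Qed.

Lemma phi_a_neq0 : alpha != 0.
Proof.
apply/eqP => a0; have e : phi a = 1%g.
  apply: (coords_inj n_gt1); rewrite (coords1 n_gt1).
  by move: a0 phi_a_height; case: coords => x y /= -> ->.
have := coords_bs_a n_gt1.
have -> : a = 1%g by apply: phi_inj; rewrite e hom1.
by rewrite (coords1 n_gt1) => -[].
Qed.

(** The rational coordinates in the image of ta = a^n t give q^k alpha = n alpha, where k is the
    height of [phi t]; now cancel alpha. *)
Lemma phi_t_height : (coords (phi t)).2 = 1.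
Proof.
have /(congr1 (fun g => (coords (phi g)).1)) := bs_ta n.
rewrite !gmulfM !homX !(coordsM n_gt1) /= (coordsX0 n_gt1) ?phi_a_height //.
rewrite expr0z mul1r addrC => /addIr /eqP; rewrite mulrC.
move/eqP/(mulfI phi_a_neq0) => e.
have q0 : 0 < q by apply: lt_trans q_gt1.
by apply: (ieexprIz q0); rewrite ?gt_eqF // expr1z.
Qed.

(** The factor of [beta] in the rational coordinate of the k-th power of [phi t], negative k
    included. *)
Definition geomz (k : int) : rat := (q ^ k - 1) / (q - 1).

Lemma geomzD k l : geomz (k + l) = geomz k + q ^ k * geomz l.
Proof. by rewrite /geomz expfzDr //; field. Qed.

Lemma geomz_nat k : geomz k%:Z = (geom n k)%:R.
Proof.
apply: (mulIf q1_neq0); rewrite /geomz mulfVK //.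
elim: k => [|k IHk]; first by rewrite /geom big_ord0 expr0z subrr mul0r.
rewrite /geom big_ord_recr /= natrD mulrDl -IHk natrX -/q -!exprnP exprS.
by ring.
Qed.

(** The formula holds at a and t and, by the cocycle identity [geomzD], passes to products and
    inverses. *)
Lemma coords_phi g :
  coords (phi g) =
  (alpha * (coords g).1 + beta * geomz (coords g).2, (coords g).2).
Proof.
pose P g := coords (phi g) =
  (alpha * (coords g).1 + beta * geomz (coords g).2, (coords g).2).
have PM x y : P x -> P y -> P (x * y)%g.
  rewrite /P => Px Py.
  rewrite gmulfM !(coordsM n_gt1) Px Py /smul /= geomzD -/q.
  congr (_, _); case: (coords x) (coords y) => x1 k [y1 l] /=.
  by move: alpha beta (q ^ k) (geomz _) (geomz _) => al be c d e; ring.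
have PV x : P x -> P x^-1%g.
  rewrite /P => Px; rewrite homV !(coordsV n_gt1) Px /=; congr (_, _).
  have := geomzD (- (coords x).2) (coords x).2.
  rewrite addNr {1}/geomz expr0z subrr mul0r => e.
  have -> : geomz (- (coords x).2) =
      - (q ^ (- (coords x).2) * geomz (coords x).2).
    by apply/eqP; rewrite -addr_eq0 -e.
  rewrite -/q; case: (coords x) => x1 k /=.
  by move: alpha beta (q ^ _) (geomz _) => al be c d; ring.
have Pa : P a.
  rewrite /P (coords_bs_a n_gt1) /= /geomz expr0z subrr mul0r mulr0 addr0 mulr1.
  by move: phi_a_height; case: coords => x y /= ->.
have Pt : P t.
  rewrite /P (coords_bs_t n_gt1) /= /geomz expr1z divff // mulr0 add0r mulr1.
  by move: phi_t_height; case: coords => x y /= ->.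
have P1 : P 1%g by rewrite -(mulVg a); apply: PM => //; apply: PV.
rewrite -/(P g) -[g]bs_eval_repr; elim: (repr g : bs_word) => //= l u IHu.
rewrite -cat1s bs_eval_cat; apply: PM => //.
by case: l => -[] [] //; rewrite bs_eval_inv; apply: PV.
Qed.

(** Since [phi] preserves heights, only the rational coordinate imposes a condition. *)
Lemma fixedE g : fixed phi g =
  ((1 - alpha) * (coords g).1 == beta * geomz (coords g).2).
Proof.
rewrite -[fixed phi g]/(phi g == g) -(inj_eq (coords_inj n_gt1)) coords_phi.
rewrite [X in _ == X]surjective_pairing xpair_eqE eqxx andbT.
move: (coords g).1 alpha (beta * _) => x al b; rewrite mulrBl mul1r.
by apply/eqP/eqP => [{1}<-|<-]; rewrite ?addKr ?subrKC // addrC addKr.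
Qed.

(** * The case alpha = 1 *)

Lemma geomz_eq0 k : (geomz k == 0) = (k == 0).
Proof.
rewrite /geomz mulf_eq0 invr_eq0 (negbTE q1_neq0) orbF subr_eq0.
have q0 : 0 < q by apply: lt_trans q_gt1.
by rewrite -(expr0z q) (inj_eq (ieexprIz q0 _)) // gt_eqF.
Qed.

(** Here beta is nonzero because [phi] is not the identity, so the fixed elements are those of
    height 0, and on them the rational coordinate is additive. *)
Lemma Fix_unipotent : alpha = 1 -> ~ phi =1 id ->
  isomorphic (Fix phi) (Zinv_group n).
Proof.
move=> al1 phi_n1.
have be0 : beta != 0.
  apply/eqP => be0; apply: phi_n1 => g; apply: (coords_inj n_gt1).
  by rewrite coords_phi al1 be0 mul1r mul0r addr0 -surjective_pairing.
have fix0 g : fixed phi g = ((coords g).2 == 0).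
  by rewrite fixedE al1 subrr mul0r eq_sym mulf_eq0 (negbTE be0) geomz_eq0.
have Xp (g : BS n) : zinv_pred n (coords g).1.
  by apply/asboolP; have [i [l ->]] := coords1_den n_gt1 g; exists l, i.
pose f (g : Fix phi) : Zinv_group n := exist _ (coords (val g)).1 (Xp (val g)).
have K0 (g : Fix phi) : (coords (val g)).2 = 0.
  by apply/eqP; rewrite -fix0; apply: valP.
apply: (@isomorphic_intro _ _ f).
- move=> g h; apply: val_inj.
  change ((coords (val (g * h)%g)).1 = (coords (val g)).1 + (coords (val h)).1).
  by rewrite valM (coordsM n_gt1) /smul K0 /= expr0z mul1r.
- move=> g h /(congr1 val) /= e; apply/val_inj/(coords_inj n_gt1).
  by rewrite [LHS]surjective_pairing [RHS]surjective_pairing e !K0.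
case=> x xP; have /asboolP[l [i xE]] := xP.
(* [p] and [r] are the positive and negative parts of the numerator, so that t^-i a^(p - r) t^i is a
   preimage. *)
pose p := (if l is Posz p then p else 0)%N.
pose r := (if l is Negz r then r.+1 else 0)%N.
have lE : l%:~R = p%:R - r%:R :> rat.
  by rewrite /p /r; case: (l) => m /=; rewrite ?subr0 // sub0r NegzE mulrNz.
pose g := bs_eval n (nf_word i p r i).
have gE : coords g = (x, 0).
  by rewrite (coords_eval n_gt1) (word_coords_nf n_gt1) subrr xE lE.
have gF : fixed phi g by rewrite fix0 gE.
by exists (exist _ g gF); apply: val_inj; rewrite /= gE.
Qed.

(* A nontrivial element of [Z] is not infinitely [n]-divisible. *)
Lemma Fix_unipotent_notZ : alpha = 1 -> ~ isomorphic (Fix phi) Z_group.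
Proof.
move=> al1 [f /bij_inj f_inj].
(* The elements t^-i a t^i have coordinates (1/n^i, 0): each is the n-th power of the next one. *)
have fixX i : fixed phi (bs_eval n (nf_word i 1 0 i)).
  rewrite fixedE al1 subrr mul0r (coords_eval n_gt1) (word_coords_nf n_gt1) /=.
  by rewrite subrr eq_sym mulf_eq0 geomz_eq0 eqxx orbT.
pose g i : Fix phi := exist _ (bs_eval n (nf_word i 1 0 i)) (fixX i).
have gX i : (g i.+1 ^+ n = g i)%g.
  apply/val_inj/(coords_inj n_gt1); rewrite gmulfXn /=.
  have e j : coords (bs_eval n (nf_word j 1 0 j)) = (1 / q ^+ j, 0).
    by rewrite (coords_eval n_gt1) (word_coords_nf n_gt1) subrr subr0.
  rewrite (coordsX0 n_gt1) !e //= -/q; congr (_, _).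
  by rewrite exprS; field; rewrite expf_neq0.
have ZX (z : Z_group) m : (z ^+ m)%g = (z : int) * m%:Z :> int.
  elim: m => [|m IHm]; first by rewrite expg0 mulr0.
  by rewrite expgS intS mulrDr mulr1 -IHm.
have fg i : (f (g 0%N) : int) = (f (g i) : int) * (n ^ i)%N%:Z.
  elim: i => [|i ->]; first by rewrite mulr1.
  by rewrite -gX homX ZX expnS PoszM mulrA.
have f0 : (f (g 0%N) : int) != 0.
  apply/eqP => f0; have : g 0%N = 1%g by apply: f_inj; rewrite hom1.
  move/(congr1 (fun g => (coords (val g)).1)).
  rewrite val1 (coords1 n_gt1) (coords_eval n_gt1) (word_coords_nf n_gt1) /=.
  by rewrite subr0 expr0 divr1 => /eqP; rewrite oner_eq0.
(* The nonzero integer of absolute value [m] would be divisible by n^m, which exceeds [m]. *)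
set m := `|(f (g 0%N) : int)|%N.
have /(congr1 absz) := fg m; rewrite abszM absz_nat -/m.
have m0 : (0 < m)%N by rewrite absz_gt0.
have := ltn_expl m n_gt1; move: `|_|%N (n ^ m)%N => y z lt_mz mE.
case: y mE => [|y] mE; first by rewrite mE in m0.
by move: lt_mz; rewrite mE mulSn; lia.
Qed.

End Injective.

(** * Computing a generator *)

(* With the notation of the header: [affine_den] is [|A|], [affine_num] is [|B|],
  and [affine_neg] says that [A] and [B] have opposite signs (if nonzero). *)
Definition affine_den n h cu :=
  distn (n ^ h + weight 2 n h h cu) (weight 1 n h h cu).
Definition affine_num n h cv := distn (weight 1 n h h cv) (weight 2 n h h cv).
Definition affine_neg n h cu cv :=
  (weight 1 n h h cv <= weight 2 n h h cv) !=
  (n ^ h + weight 2 n h h cu <= weight 1 n h h cu).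

(** The codes bound the lengths of the two words, so [cu + cv] is a height that serves both. Divided
    by D, the result is the absolute value of the exponent l of the generator. *)
Definition fix_dividend k n cu cv :=
  let h := cu + cv in
  affine_num n h cv * geom n k * n ^ affine_den n h cu.
Definition fix_test k n cu cv :=
  fix_dividend k n cu cv %% affine_den n (cu + cv) cu.
(** The digit 4 stands for t^-1, the next one (1 or 2) for a or a^-1 according to the sign of l, and
    3 for t. *)
Definition fix_output k n cu cv :=
  let D := affine_den n (cu + cv) cu in
  prepend 4 D (prepend (affine_neg n (cu + cv) cu cv + 1)
    (fix_dividend k n cu cv %/ D) (prepend 3 (D + k) 0)).

Definition signed_word D l (s : bool) k : bs_word :=
  nseq D (gen_t, true) ++ nseq l (gen_a, s) ++ nseq (D + k) (gen_t, false).

(** * Correctness of the operations on codes *)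

Lemma word_code_nseq m l u :
  word_code (nseq m l ++ u) = prepend (letter_code l) m (word_code u).
Proof. by elim: m => //= m ->. Qed.

Lemma fix_outputE k n cu cv : fix_output k n cu cv =
  word_code (signed_word (affine_den n (cu + cv) cu)
    (fix_dividend k n cu cv %/ affine_den n (cu + cv) cu)
    (affine_neg n (cu + cv) cu cv) k).
Proof. by rewrite /signed_word -[nseq (_ + k) _]cats0 !word_code_nseq. Qed.

Lemma size_word_code u : size u <= word_code u.
Proof. by elim: u => //= l u IHu; rewrite /letter_code; lia. Qed.

Lemma letter_code_bounds l : 0 < letter_code l <= 4.
Proof. by case: l => -[] []. Qed.

Lemma suffix_codeS l u i :
  suffix_code (word_code (l :: u)) i.+1 = suffix_code (word_code u) i.
Proof.
rewrite /suffix_code iterSr; congr (iter i _ _).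
by have := letter_code_bounds l; rewrite /=; lia.
Qed.

Lemma digit0 l u : digit (word_code (l :: u)) 0 = letter_code l.
Proof. by rewrite /digit suffix_codeS /=; lia. Qed.

Lemma digitS l u i : digit (word_code (l :: u)) i.+1 = digit (word_code u) i.
Proof. by rewrite /digit !suffix_codeS. Qed.

Lemma digit_nil i : digit 0 i = 0.
Proof.
by rewrite /digit /suffix_code; elim: i => // i; rewrite !iterS; lia.
Qed.

Lemma heightS h l u i : height h (word_code (l :: u)) i.+1 =
  height (h + (letter_code l == 3) - (letter_code l == 4)) (word_code u) i.
Proof.
elim: i => [|i IHi].
  by rewrite /height /= -[_ + 4 * _]/(word_code (l :: u)) digit0.
rewrite -[LHS]/(height h (word_code (l :: u)) i.+1
  + (digit (word_code (l :: u)) i.+1 == 3)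
  - (digit (word_code (l :: u)) i.+1 == 4)).
by rewrite IHi digitS.
Qed.

Lemma weight_cons d n m h l u : weight d n m.+1 h (word_code (l :: u)) =
  (letter_code l == d) * n ^ h +
  weight d n m (h + (letter_code l == 3) - (letter_code l == 4)) (word_code u).
Proof.
rewrite /weight big_ord_recl digit0; congr (_ + _).
by apply: eq_bigr => i _; rewrite lift0 heightS digitS.
Qed.

(** * Integer forms of the coordinates *)

Section FixedGenerator.
Local Open Scope ring_scope.

(** Induction on the word: a first letter a or a^-1 contributes n^h or -n^h, and t or t^-1 shifts h
    by one. The bound on [h] keeps subtraction exact; digits past the end of the word are 0 and add
    nothing. *)
Lemma weight_word_coords n m h u :
  (1 < n)%N -> (size u <= m)%N -> (size u <= h)%N ->
  (weight 1 n m h (word_code u))%:R - (weight 2 n m h (word_code u))%:R =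
  n%:R ^+ h * (word_coords n u).1 :> rat.
Proof.
move=> n_gt1; elim: u m h => [|l u IHu] [|m] h //= sz_m sz_h;
  try by rewrite /weight !big1 ?subrr ?mulr0 // => i _; rewrite digit_nil.
have q0 := q_neq0 n_gt1.
rewrite -[(_ + 4 * _)%N]/(word_code (l :: u)) !weight_cons.
case: l => -[] [] /=; rewrite ?(addn0, subn0, mul0n, mul1n, add0n).
- have := IHu m h sz_m (ltnW sz_h); move: (weight _ _ _ _ _) (weight _ _ _ _ _).
  by move=> x y e; rewrite expr0z natrD natrX mul1r mulrDr -e mulrN1; ring.
- have := IHu m h sz_m (ltnW sz_h); move: (weight _ _ _ _ _) (weight _ _ _ _ _).
  by move=> x y e; rewrite expr0z natrD natrX mul1r mulrDr -e mulr1; ring.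
(* The letter t^-1: here h is positive, since it is at least the length of the word. *)
- case: h sz_h => // h sz_h; rewrite subn1 /= IHu // add0r exprS.
  by rewrite -exprnN expr1; field.
- by rewrite addn1 IHu ?(leqW (ltnW sz_h)) // add0r exprSr expr1z mulrA.
Qed.

Lemma coords_signed_word n (n_gt1 : (1 < n)%N) d l b k :
  coords (bs_eval n (signed_word d l b k)) =
  ((-1) ^+ b * l%:R / n%:R ^+ d, k%:Z).
Proof.
rewrite (coords_eval n_gt1) !(word_coords_cat n_gt1) !word_coords_nseq_a.
rewrite !word_coords_nseq_t /smul /= !expr0z; congr (_, _); last by lia.
rewrite mulN1r -exprz_inv -exprnP exprVn.
by move: ((-1) ^+ b) => x; field; rewrite expf_neq0 ?q_neq0.
Qed.

(** If x = y the sign is -1, harmlessly, as the distance is 0. *)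
Lemma distn_signr x y :
  x%:R - y%:R = (-1) ^+ (x <= y)%N * (distn x y)%:R :> rat.
Proof.
rewrite /distn; case: leqP => [le|/ltnW le].
  by rewrite (eqP le) add0n natrB // mulN1r opprB.
by rewrite (eqP (le : y - x == 0)%N) addn0 natrB // mul1r.
Qed.

(** * The case alpha different from 1 *)

Section Semisimple.
Variables (n : nat) (phi : {multiplicative BS n -> BS n}).
Hypotheses (n_gt1 : (1 < n)%N) (phi_inj : injective phi).

Let q : rat := n%:R.
Let q_neq0 : q != 0 := q_neq0 n_gt1.

Local Notation alpha := (coords (phi (bs_a n))).1.
Local Notation beta := (coords (phi (bs_t n))).1.

Hypothesis alpha_neq1 : alpha != 1.

Let coeff_neq0 : 1 - alpha != 0.
Proof. by rewrite subr_eq0 eq_sym. Qed.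

Lemma fixed_height_inj g h : fixed phi g -> fixed phi h ->
  (coords g).2 = (coords h).2 -> g = h.
Proof.
rewrite !fixedE // => /eqP gF /eqP hF gh; apply: (coords_inj n_gt1).
rewrite [LHS]surjective_pairing [RHS]surjective_pairing gh; congr (_, _).
by apply: (mulfI coeff_neq0); rewrite gF hF gh.
Qed.

(** Euclidean division of heights: the remainder is the height of a fixed element, so it vanishes by
    minimality of k, and height determines a fixed element. *)
Lemma fixed_generator w (k : nat) : fixed phi w -> (coords w).2 = k%:Z ->
  (0 < k)%N ->
  (forall g m, fixed phi g -> (coords g).2 = m%:Z -> (0 < m)%N -> (k <= m)%N) ->
  is_generator (fixed phi) w.
Proof.
move=> wF wk k0 k_min; split=> // h hF.
have [F1 FF] := fixed_closed phi.
have FX m : (w ^+ m)%g \in fixed phi.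
  elim: m => [|m IHm] //; rewrite expgSr -[w in (_ * w)%g]invgK.
  by apply: (FF) => //; rewrite -div1g; apply: FF.
have FV g : g \in fixed phi -> (g^-1)%g \in fixed phi.
  by rewrite -div1g; apply: FF.
(* Passing to the inverse reduces to nonnegative heights. *)
wlog [m hm] : h hF / exists m : nat, (coords h).2 = m%:Z => [IH|].
  case E : (coords h).2 => [m|m]; first by apply: IH => //; exists m.
  have [||j [e|e]] := IH h^-1%g; first exact: FV.
  - by exists m.+1; rewrite (coordsV n_gt1) E.
  - by exists j; right; rewrite -e invgK.
  - by exists j; left; rewrite -[h]invgK e invgK.
exists (m %/ k)%N; left.
have rE : (coords (h / w ^+ (m %/ k))%g).2 = (m %% k)%N%:Z.
  rewrite (coordsM n_gt1) (coordsV n_gt1) /= (coordsX n_gt1) hm wk.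
  by rewrite {1}(divn_eq m k); lia.
apply/eqP; rewrite -divg_eq1; apply/eqP/fixed_height_inj => //.
  exact: FF.
rewrite rE (coords1 n_gt1); have [->//|r0] := posnP (m %% k)%N.
have := k_min _ _ (FF _ _ hF (FX _)) rE r0.
by rewrite leqNgt ltn_mod k0.
Qed.

(** Every fixed element has height a multiple of k; the isomorphism is the height divided by k. *)
Lemma Fix_infinite_cyclic w (k : nat) : (coords w).2 = k%:Z -> (0 < k)%N ->
  is_generator (fixed phi) w -> isomorphic (Fix phi) Z_group.
Proof.
move=> wk k0 [wF w_gen].
have wX m : (coords (w ^+ m)%g).2 = m%:Z * k%:Z.
  by rewrite (coordsX n_gt1) wk mulrC.
have kK g : fixed phi g -> exists m : int, (coords g).2 = m * k%:Z.
  case/w_gen => m [->|->]; first by exists m%:Z.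
  by exists (- m%:Z); rewrite (coordsV n_gt1) /= wX mulNr.
have kz : k%:Z != 0 by rewrite eqz_nat -lt0n.
pose f (g : Fix phi) : Z_group := ((coords (val g)).2 %/ k%:Z)%Z.
apply: (@isomorphic_intro _ _ f).
- move=> g h.
  change (((coords (val (g * h)%g)).2 %/ k%:Z)%Z =
          ((coords (val g)).2 %/ k%:Z)%Z + ((coords (val h)).2 %/ k%:Z)%Z).
  rewrite valM (coordsM n_gt1) /smul.
  have [[m ->] [m' ->]] := (kK _ (valP g), kK _ (valP h)).
  by rewrite -mulrDl !mulzK.
- move=> g h e; apply/val_inj/fixed_height_inj; try exact: valP.
  have [[m gm] [m' hm]] := (kK _ (valP g), kK _ (valP h)).
  by move: e; rewrite /f gm hm !mulzK // => ->.
pose wF' : Fix phi := exist _ w wF.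
case=> m; [exists (wF' ^+ m)%g | exists (wF' ^- m.+1)%g].
  by rewrite /f gmulfXn wX mulzK.
by rewrite /f gmulfV gmulfXn (coordsV n_gt1) /= wX -mulNr mulzK // NegzE.
Qed.

Section Coefficients.
Variables (h : nat) (u v : bs_word).
Hypotheses (phi_a : phi (bs_a n) = bs_eval n u).
Hypotheses (phi_t : phi (bs_t n) = bs_eval n v).
Hypotheses (size_u : (size u <= h)%N) (size_v : (size v <= h)%N).

Local Notation X := (n ^ h + weight 2 n h h (word_code u))%N.
Local Notation Y := (weight 1 n h h (word_code u)).
Local Notation P := (weight 1 n h h (word_code v)).
Local Notation N := (weight 2 n h h (word_code v)).
Local Notation D := (affine_den n h (word_code u)).
Local Notation B := (affine_num n h (word_code v)).
Local Notation s := (affine_neg n h (word_code u) (word_code v)).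

(** The summand n^h of [X] accounts for the 1 in 1 - alpha. *)
Lemma alphaE : q ^+ h * (1 - alpha) = X%:R - Y%:R.
Proof.
rewrite phi_a (coords_eval n_gt1) mulrBr -/q.
rewrite -(weight_word_coords n_gt1 size_u size_u).
by rewrite natrD natrX -/q; ring.
Qed.

Lemma betaE : q ^+ h * beta = P%:R - N%:R.
Proof.
by rewrite phi_t (coords_eval n_gt1) -(weight_word_coords n_gt1 size_v size_v).
Qed.

Lemma affine_den_gt0 : (0 < D)%N.
Proof.
rewrite lt0n; apply/eqP => D0; have := alphaE; rewrite distn_signr.
rewrite -/(affine_den _ _ _) D0 mulr0 => /eqP.
by rewrite mulf_eq0 (negbTE coeff_neq0) (negbTE (expf_neq0 _ q_neq0)).
Qed.

(** Write the rational coordinate of g as c/n^i. Clearing denominators in the fixed point equation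
    yields divisibility with n^i, which is then replaced by n^D. *)
Lemma fixed_dvdn g k : fixed phi g -> (coords g).2 = k%:Z ->
  (D %| B * geom n k * n ^ D)%N.
Proof.
rewrite fixedE // => /eqP gF gk; have [i [c gc]] := coords1_den n_gt1 g.
apply: (dvdn_expn_stable (i := i) affine_den_gt0).
move: gF; rewrite gk geomz_nat // gc -/q => e.
have {e} : (X%:Z - Y%:Z) * c = (P%:Z - N%:Z) * (geom n k)%:Z * (n ^ i)%N%:Z.
  apply: (@intr_inj rat).
  rewrite !intrM !intrB -!pmulrn -alphaE -betaE natrX -/q.
  rewrite -[_ * beta * _]mulrA -e; field; exact: expf_neq0.
move=> /(congr1 absz); rewrite !abszM !absz_nat.
have absE x y : `|x%:Z - y%:Z|%N = distn x y by rewrite /distn; lia.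
by rewrite !absE => <-; apply: dvdn_mulr.
Qed.

(** Conversely, the quotient is the exponent of a in a solution; the fixed point equation is checked
    after multiplication by n^(h + D). *)
Lemma dvdn_fixed k : (D %| B * geom n k * n ^ D)%N ->
  fixed phi (bs_eval n (signed_word D ((B * geom n k * n ^ D) %/ D) s k)).
Proof.
move=> /divnK lE.
rewrite fixedE // (coords_signed_word n_gt1) /= -/q geomz_nat //.
set l := (_ %/ _)%N in lE *; apply/eqP.
have qh : q ^+ h * q ^+ D != 0 by rewrite mulf_neq0 ?expf_neq0.
apply: (mulfI qh).
transitivity ((q ^+ h * (1 - alpha)) * ((-1) ^+ s * l%:R)).
  by move: (1 - alpha) ((-1) ^+ s) => x y; field; rewrite expf_neq0.
transitivity ((q ^+ h * beta) * ((geom n k)%:R * q ^+ D)); last by ring.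
rewrite alphaE betaE !distn_signr -!/(affine_den _ _ _) -!/(affine_num _ _ _).
move/(congr1 (fun x => x%:R : rat)): lE; rewrite !natrM natrX -/q => lE.
(* The sign of B is that of A times the sign given to l. *)
have -> : (-1) ^+ (P <= N)%N = (-1) ^+ (X <= Y)%N * (-1) ^+ s :> rat.
  by rewrite -signr_addb /affine_neg; case: (P <= N)%N; case: (X <= Y)%N.
move: ((-1) ^+ s) ((-1) ^+ (X <= Y)%N) => y x.
transitivity (x * y * (l%:R * D%:R)); first by ring.
by rewrite lE; ring.
Qed.

End Coefficients.

(** The search variable is one less than the height, so only positive heights are tried. The least
    success is the least positive height of a fixed element. *)
Lemma fix_test_spec u v : phi (bs_a n) = bs_eval n u ->
  phi (bs_t n) = bs_eval n v ->
  exists k, [/\ forall x, (x < k)%N ->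
      fix_test x.+1 n (word_code u) (word_code v) != 0%N,
    fix_test k.+1 n (word_code u) (word_code v) = 0%N &
    exists w, [/\ fix_output k.+1 n (word_code u) (word_code v) = word_code w,
      (coords (bs_eval n w)).2 = k.+1%:Z &
      is_generator (fixed phi) (bs_eval n w)]].
Proof.
move=> phi_a phi_t; set h := (word_code u + word_code v)%N.
have size_u : (size u <= h)%N.
  by rewrite (leq_trans (size_word_code _)) ?leq_addr.
have size_v : (size v <= h)%N.
  by rewrite (leq_trans (size_word_code _)) ?leq_addl.
have D0 := affine_den_gt0 phi_a size_u.
have testP k : fix_test k n (word_code u) (word_code v) == 0%N =
    (affine_den n h (word_code u)
       %| fix_dividend k n (word_code u) (word_code v))%N.
  by [].
(* The search halts: some k > 0 already satisfies the divisibility without the factor B. *)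
have : exists k, fix_test k.+1 n (word_code u) (word_code v) == 0%N.
  have [[|k] // _ kD] := exists_geom_dvdn n D0.
  by exists k; rewrite testP /fix_dividend -mulnA dvdn_mull.
case/ex_minnP => k k_test k_min.
have wF := dvdn_fixed phi_a phi_t size_u size_v
  (etrans (esym (testP _)) k_test).
exists k; split.
- move=> x xk; apply: contraTneq xk => x_test.
  by rewrite -leqNgt k_min // x_test.
- exact/eqP.
eexists; split; first exact: fix_outputE.
  by rewrite (coords_signed_word n_gt1).
apply: (fixed_generator wF); rewrite ?(coords_signed_word n_gt1) //.
move=> g [//|m] gF gm _; rewrite ltnS k_min // testP.
exact: (fixed_dvdn phi_a phi_t size_u size_v gF gm).
Qed.

End Semisimple.

End FixedGenerator.

(** * The search is partial recursive *)

Section FixComputable.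
Variable k : nat.
Implicit Types (f g m n h cu cv : seq nat -> nat).

Lemma rc_geom n m : recursive k n -> recursive k m ->
  recursive k (fun s => geom (n s) (m s)).
Proof.
move=> nP mP; apply: (@rc_sum _ _ (fun i s => n s ^ i)) => //.
by apply: rc_exp (rc_drop2 _) (rc_nth _).
Qed.

Lemma rc_affine_den n h cu : recursive k n -> recursive k h -> recursive k cu ->
  recursive k (fun s => affine_den (n s) (h s) (cu s)).
Proof.
move=> *; apply: rc_distn; last exact: rc_weight.
by apply: rc_add; [apply: rc_exp | apply: rc_weight].
Qed.

Lemma rc_affine_num n h cv : recursive k n -> recursive k h -> recursive k cv ->
  recursive k (fun s => affine_num (n s) (h s) (cv s)).
Proof. by move=> *; apply: rc_distn; apply: rc_weight. Qed.

Lemma rc_affine_neg n h cu cv : recursive k n -> recursive k h ->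
  recursive k cu -> recursive k cv ->
  recursive k (fun s => affine_neg (n s) (h s) (cu s) (cv s)).
Proof.
(* Inequality of two truth values is one minus their equality as numbers. *)
move=> nP hP cuP cvP; apply: (@eq_rc _ (fun s => 1 -
  (((weight 1 (n s) (h s) (h s) (cv s) <= weight 2 (n s) (h s) (h s) (cv s)) :
    nat) ==
  ((n s ^ h s + weight 2 (n s) (h s) (h s) (cu s) <=
     weight 1 (n s) (h s) (h s) (cu s)) : nat)))).
  apply: rc_sub (rc_const _ _) _; apply: rc_eq; apply: rc_leq;
    try exact: rc_weight.
  by apply: rc_add; [apply: rc_exp | apply: rc_weight].
by move=> s _; rewrite /affine_neg; do 2!case: (_ <= _).
Qed.

Variables m n cu cv : seq nat -> nat.
Hypotheses (mP : recursive k m) (nP : recursive k n).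
Hypotheses (cuP : recursive k cu) (cvP : recursive k cv).

Lemma rc_fix_dividend :
  recursive k (fun s => fix_dividend (m s) (n s) (cu s) (cv s)).
Proof.
have hP := rc_add cuP cvP.
apply: rc_mul; first by apply: rc_mul; [apply: rc_affine_num | apply: rc_geom].
by apply: rc_exp => //; apply: rc_affine_den.
Qed.

Lemma rc_fix_test : recursive k (fun s => fix_test (m s) (n s) (cu s) (cv s)).
Proof.
by apply: rc_mod; [apply: rc_fix_dividend | apply: rc_affine_den => //;
  apply: rc_add].
Qed.

Lemma rc_fix_output :
  recursive k (fun s => fix_output (m s) (n s) (cu s) (cv s)).
Proof.
have hP := rc_add cuP cvP; have dP := rc_affine_den nP hP cuP.
apply: rc_prepend => //; first exact: rc_const.
apply: rc_prepend.
- by apply: rc_add (rc_const _ _); apply: rc_affine_neg.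
- exact: rc_div rc_fix_dividend _.
by apply: rc_prepend; [apply: rc_const | apply: rc_add | apply: rc_const].
Qed.

End FixComputable.

(** The value found by minimisation is passed to [g] in front of the original inputs, which
    projections supply. *)
Lemma rc_comp_mu k f g : recursive k.+1 f -> recursive k.+1 g ->
  exists F : recfun k, forall (v : k.-tuple nat) y,
    (forall x, x < y -> f (x :: v) != 0) -> f (y :: v) = 0 ->
    computes F v (g (y :: v)).
Proof.
move=> /rc_mu[M MP] [G GP].
exists (rec_comp G (fun i => if unlift ord0 i is Some j then rec_proj j else
  M)).
move=> v y lt0 eq0; apply: (@computes_comp _ _ _ _ _ [tuple of y :: v]).
  move=> i; case: unliftP => [j|] ->; last by rewrite tnth0; apply: MP.
  by rewrite tnthS; apply: computes_proj.
exact: GP.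
Qed.

Theorem theorem1p1 :
  (forall (n : nat) (phi : {multiplicative BS n -> BS n}),
     2 <= n -> bijective phi -> ~ (phi =1 id) ->
     isomorphic (Fix phi) Z_group \/ isomorphic (Fix phi) (Zinv_group n)) /\
  (exists F : recfun 3,
     forall (n : nat) (phi : {multiplicative BS n -> BS n}) (u v : bs_word),
       2 <= n -> bijective phi -> ~ (phi =1 id) ->
       phi (bs_a n) = bs_eval n u -> phi (bs_t n) = bs_eval n v ->
       isomorphic (Fix phi) Z_group ->
       exists w : bs_word,
         computes F [tuple n; word_code u; word_code v] (word_code w) /\
         is_generator (fixed phi) (bs_eval n w)).
Proof.
split=> [n phi n_gt1 /bij_inj phi_inj phi_n1|].
  have [al1|al1] := eqVneq (coords (phi (bs_a n))).1 1%R.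
    by right; apply: Fix_unipotent.
  (* Any words representing the two images will do; the canonical representatives are taken. *)
  left; have [k [_ _ [w [_ wk w_gen]]]] := fix_test_spec n_gt1 phi_inj al1
    (esym (bs_eval_repr (phi (bs_a n)))) (esym (bs_eval_repr (phi (bs_t n)))).
  exact: (Fix_infinite_cyclic n_gt1 phi_inj al1 wk).
have nthP i : i < 4 -> recursive 4 (fun s => nth 0 s i) by apply: rc_nth.
have [F FP] := rc_comp_mu
  (rc_fix_test (rc_succ (nthP 0 isT)) (nthP 1 isT) (nthP 2 isT) (nthP 3 isT))
  (rc_fix_output (rc_succ (nthP 0 isT)) (nthP 1 isT) (nthP 2 isT) (nthP 3 isT)).
exists F => n phi u v n_gt1 /bij_inj phi_inj _ phi_a phi_t isoZ.
(* If alpha were 1, the fixed subgroup could not be isomorphic to Z. *)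
have al1 : (coords (phi (bs_a n))).1 != 1%R.
  by apply/eqP => al1; apply: (Fix_unipotent_notZ n_gt1 phi_inj al1).
have [k [k_min k_test [w [wE _ w_gen]]]] :=
  fix_test_spec n_gt1 phi_inj al1 phi_a phi_t.
by exists w; split=> //; rewrite -wE; apply: (FP [tuple n; _; _]).
Qed.
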